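(* Suppose the Kleinian group $\Gamma$ admits a DF domain $P$. Then the planes $R_\gamma$, for side-pairings $\gamma\in\Gamma\setminus\Gamma_\infty$ of $P$, all intersect in a vertical axis (i.e. there is a vertical geodesic contained in every such $R_\gamma$). Furthermore, for each such $\gamma$, $\gamma_4\circ\gamma_3=1$ (so that $\gamma=\gamma_2\circ\gamma_1$), and so each element of the corresponding generating set for $\Gamma$ (the set of side-pairings of $P$) has real trace.
   Context: $\mathbb{H}^3$ is upper half-space $\mathbb{C}\times(0,\infty)$ with hyperbolic distance $d$; orientation-preserving isometries are identified with $\mathrm{PSL}_2(\mathbb{C})$. A Kleinian group is a discrete subgroup of $\mathrm{PSL}_2(\mathbb{C})$. Standing assumptions: $\Gamma$ is finitely generated and of finite covolume, and (when Ford domains are discussed) the stabilizer $\Gamma_\infty<\Gamma$ of $\infty$ contains a copy of $\mathbb{Z}^2$ (acting by parabolics). A fundamental domain for $\Gamma$ is a closed convex polyhedron whose $\Gamma$-translates cover $\mathbb{H}^3$ and whose interior is disjoint from its translates by nontrivial elements of $\Gamma$. The Dirichlet domain centered at $w_0\in\mathbb{H}^3$ is $\{x\in\mathbb{H}^3: d(x,w_0)\le d(x,\alpha(w_0))\ \forall\,1\ne\alpha\in\Gamma\}$. For $\gamma=\pm\begin{pmatrix}a&b\\c&d\end{pmatrix}\in\Gamma\setminus\Gamma_\infty$, the isometric sphere $S_\gamma$ is the hemisphere in $\mathbb{H}^3$ with center $-d/c\in\mathbb{C}$ and radius $1/|c|$. A Ford domain is the intersection of the set of points lying on or outside all isometric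 spheres $S_\gamma$, $\gamma\in\Gamma\setminus\Gamma_\infty$, with a fundamental domain for the action of $\Gamma_\infty$ that is the vertical chimney above a fundamental polygon for $\Gamma_\infty$ acting on $\mathbb{C}$. A DF domain for $\Gamma$ is a fundamental domain for $\Gamma$ which is both a Ford domain and a Dirichlet domain for some center $w_0\in\mathbb{H}^3$. A side-pairing of $P$ is an element $\gamma\in\Gamma$ such that $P\cap\gamma^{-1}(P)$ is a side (2-dimensional face) of $P$; it maps this side to the side $P\cap\gamma(P)$. The side-pairings generate $\Gamma$. Each $\gamma\in\Gamma\setminus\Gamma_\infty$ can be written $\gamma=\gamma_4\circ\gamma_3\circ\gamma_2\circ\gamma_1$, where $\gamma_1$ is reflection in the isometric sphere $S_\gamma$, $\gamma_2$ is reflection in the vertical plane $R_\gamma$ bisecting $S_\gamma$ and $S_{\gamma^{-1}}$ (i.e. the vertical plane whose reflection exchanges these equal-radius hemispheres), and $\gamma_4\circ\gamma_3$ is a rotation about the vertical axis through the North pole (highest point) of $S_{\gamma^{-1}}$. When $S_\gamma=S_{\gamma^{-1}}$, there is a unique vertical plane $R$ through their common center such that $\gamma$ is reflection in $S_\gamma$ followed by reflection in $R$, and one takes $R_\gamma=R$. The trace of an element of $\mathrm{PSL}_2(\mathbb{C})$ is defined up to sign. *)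

(* Defs.v *)
From HB Require Import structures.
From mathcomp Require Import all_boot all_order all_algebra.
From mathcomp Require Import complex ring lra.
From mathcomp Require Import all_classical all_reals all_analysis.

Set Implicit Arguments.
Unset Strict Implicit.
Unset Printing Implicit Defensive.

Import Order.TTheory GRing.Theory Num.Theory.
Import numFieldNormedType.Exports.

Local Open Scope classical_set_scope.
Local Open Scope ring_scope.
Local Open Scope complex_scope.

Notation cabs := Normc.normc.

Section HyperbolicSpace.
Variable R : realType.
Local Notation C := R[i].

Definition H3 := {x : C * R | 0 < x.2}.

Definition hz (x : H3) : C := (val x).1.
Definition ht (x : H3) : R := (val x).2.

Lemma H3_base_subproof : 0 < ((0, 1) : C * R).2.
Proof. exact: ltr01. Qed.

(* [mkH3 z t] is the point (z, t); when t <= 0 its value is the irrelevant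
   point (0, 1). *)
Definition mkH3 (z : C) (t : R) : H3 :=
  insubd (exist _ (0, 1) H3_base_subproof : H3) (z, t).

(* cosh d = 1 + (|z - z'|^2 + (t - t')^2) / (2 t t'), and
   arcosh u = ln (u + sqrt (u^2 - 1)). *)
Definition hdist (x y : H3) : R :=
  let u := 1 + (cabs (hz x - hz y) ^+ 2 + (ht x - ht y) ^+ 2)
               / (2 * ht x * ht y) in
  ln (u + Num.sqrt (u ^+ 2 - 1)).

Definition hinterior (P : set H3) : set H3 :=
  [set x | exists2 e : R, 0 < e & forall y, hdist x y < e -> P y].

(* dx dy dt / t^3 *)
Definition hvolume (P : set H3) : \bar R :=
  (\int[(@lebesgue_measure R \x @lebesgue_measure R) \x @lebesgue_measure R]_(
     p in [set (complex.Re (hz x), complex.Im (hz x), ht x) | x in P])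
     ((p.2 ^+ 3)^-1)%:E)%E.

(* [Vertical (q, n)] is the vertical plane over the Euclidean line through q
   with normal vector n; [Hemisphere (p, r)] has center p and radius r. *)
Inductive hplane :=
| Vertical of C * C
| Hemisphere of C * R.

Definition hplane_valid (p : hplane) : Prop :=
  match p with
  | Vertical v => v.2 <> 0
  | Hemisphere s => 0 < s.2
  end.

Definition hplane_eqn (p : hplane) (x : H3) : R :=
  match p with
  | Vertical v => complex.Re (conjc v.2 * (hz x - v.1))
  | Hemisphere s => cabs (hz x - s.1) ^+ 2 + ht x ^+ 2 - s.2 ^+ 2
  end.

Definition hplane_set (p : hplane) : set H3 := [set x | hplane_eqn p x = 0].

Definition hreflection (p : hplane) (x : H3) : H3 :=
  match p with
  | Vertical v =>
      mkH3 (hz x - (2 * complex.Re (conjc v.2 * (hz x - v.1))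
                    / cabs v.2 ^+ 2)%:C * v.2) (ht x)
  | Hemisphere s =>
      let k := s.2 ^+ 2 / (cabs (hz x - s.1) ^+ 2 + ht x ^+ 2) in
      mkH3 (s.1 + k%:C * (hz x - s.1)) (k * ht x)
  end.

Definition vertical_axis (z0 : C) : set H3 := [set x | hz x = z0].

Definition vrotation (z0 u : C) (x : H3) : H3 :=
  mkH3 (z0 + u * (hz x - z0)) (ht x).

(* The boolean selects the side of the plane. *)
Definition halfspace := (hplane * bool)%type.

Definition halfspace_set (h : halfspace) : set H3 :=
  [set x | 0 <= (-1) ^+ h.2 * hplane_eqn h.1 x].

Definition closed_convex_polyhedron (P : set H3) : Prop :=
  exists F : set halfspace,
    [/\ forall h, F h -> hplane_valid h.1,
        forall (x : H3) (r : R), finite_set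
          [set h | F h /\ exists2 y, hplane_set h.1 y & hdist x y < r]
      & P = \bigcap_(h in F) halfspace_set h].

(* Two-dimensionality is expressed by nonempty interior relative to the
   supporting plane. *)
Definition is_side (P F : set H3) : Prop :=
  exists h : halfspace,
    [/\ hplane_valid h.1, P `<=` halfspace_set h,
        F = P `&` hplane_set h.1
      & exists x, exists2 e : R, F x /\ 0 < e &
          forall y, hplane_set h.1 y -> hdist x y < e -> F y].

End HyperbolicSpace.

Section Kleinian.
Variable R : realType.
Local Notation C := R[i].
Local Notation H3 := (H3 R).
Local Notation M2 := 'M[C]_2.

(* A subset of PSL_2(C) is represented by its full preimage in SL_2(C), so
   subgroups of PSL_2(C) are the subgroups of SL_2(C) containing -1, and an
   element of PSL_2(C) is trivial when its matrix is 1 or -1. *)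
Definition is_PSL2_subgroup (G : set M2) : Prop :=
  [/\ forall g, G g -> \det g = 1,
      G 1,
      forall g, G g -> G (- g),
      forall g h, G g -> G h -> G (g * h)
    & forall g, G g -> G g^-1].

Definition psl_trivial (g : M2) : Prop := g = 1 \/ g = - 1.

Definition is_discrete (G : set M2) : Prop :=
  forall g, G g -> exists2 e : R, 0 < e &
    forall h, G h -> (forall i j, cabs (h i j - g i j) < e) -> h = g.

Definition is_kleinian (G : set M2) : Prop :=
  is_PSL2_subgroup G /\ is_discrete G.

Definition finitely_generated (G : set M2) : Prop :=
  exists2 s : seq M2, forall g, g \in s -> G g &
    forall K : set M2, is_PSL2_subgroup K ->
      (forall g, g \in s -> K g) -> G `<=` K.

(* Poincare extension of z |-> (a z + b) / (c z + d), for a d - b c = 1. *)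
Definition act (g : M2) (x : H3) : H3 :=
  let a := g 0 0 in let b := g 0 1 in let c := g 1 0 in let d := g 1 1 in
  let z := hz x in let t := ht x in
  let D := cabs (c * z + d) ^+ 2 + cabs c ^+ 2 * t ^+ 2 in
  mkH3 (((a * z + b) * conjc (c * z + d) + a * conjc c * (t ^+ 2)%:C) / D%:C)
       (t / D).

Definition stab_infty (G : set M2) : set M2 := [set g | G g /\ g 1 0 = 0].

Definition is_parabolic (g : M2) : Prop :=
  ~ psl_trivial g /\ (\tr g = 2 \/ \tr g = - 2).

Definition has_parabolic_Z2 (G : set M2) : Prop :=
  exists g h : M2,
    [/\ G g, G h, g * h = h * g \/ g * h = - (h * g)
      & forall m n : int, (m, n) <> (0, 0) -> is_parabolic (g ^ m * h ^ n)].

Definition is_fundamental_domain (G : set M2) (P : set H3) : Prop :=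
  [/\ closed_convex_polyhedron P,
      forall x, exists2 g, G g & (act g @` P) x
    & forall g, G g -> ~ psl_trivial g ->
        hinterior P `&` act g @` hinterior P = set0].

Definition finite_covolume (G : set M2) : Prop :=
  exists2 P, is_fundamental_domain G P & (hvolume P < +oo)%E.

Definition dirichlet_domain (G : set M2) (w0 : H3) : set H3 :=
  [set x | forall g, G g -> ~ psl_trivial g ->
             hdist x w0 <= hdist x (act g w0)].

Definition iso_center (g : M2) : C := - g 1 1 / g 1 0.
Definition iso_radius (g : M2) : R := (cabs (g 1 0))^-1.
Definition iso_sphere (g : M2) : hplane R :=
  Hemisphere (iso_center g, iso_radius g).

Definition outside_iso_spheres (G : set M2) : set H3 :=
  [set x | forall g, G g -> ~ stab_infty G g ->
             0 <= hplane_eqn (iso_sphere g) x].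

Definition convex_polygon (D : set C) : Prop :=
  exists2 s : seq (C * C), forall h, h \in s -> h.2 <> 0 &
    D = [set z | forall h, h \in s ->
                   0 <= complex.Re (conjc h.2 * (z - h.1))].

Definition plane_interior (D : set C) : set C :=
  [set z | exists2 e : R, 0 < e & forall w, cabs (w - z) < e -> D w].

Definition affine_act (g : M2) (z : C) : C := (g 0 0 * z + g 0 1) / g 1 1.

Definition is_fundamental_polygon (G : set M2) (D : set C) : Prop :=
  [/\ convex_polygon D,
      forall z, exists2 g, G g & (affine_act g @` D) z
    & forall g, G g -> ~ psl_trivial g ->
        plane_interior D `&` affine_act g @` plane_interior D = set0].

Definition chimney (D : set C) : set H3 := [set x | D (hz x)].

Definition is_ford_domain (G : set M2) (P : set H3) : Prop :=
  exists D : set C,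
    [/\ is_fundamental_polygon (stab_infty G) D,
        is_fundamental_domain (stab_infty G) (chimney D)
      & P = outside_iso_spheres G `&` chimney D].

Definition is_DF_domain (G : set M2) (P : set H3) : Prop :=
  [/\ is_fundamental_domain G P, is_ford_domain G P
    & exists w0, P = dirichlet_domain G w0].

Definition side_pairing (G : set M2) (P : set H3) (g : M2) : Prop :=
  G g /\ is_side P (P `&` act g^-1 @` P).

Definition gamma1 (g : M2) : H3 -> H3 := hreflection (iso_sphere g).

Definition is_R_plane (g : M2) (v : C * C) : Prop :=
  let S := hplane_set (iso_sphere g) in
  let S' := hplane_set (iso_sphere g^-1) in
  [/\ hplane_valid (Vertical v),
      S <> S' -> hreflection (Vertical v) @` S = S' /\
                 hreflection (Vertical v) @` S' = S
    & S = S' ->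
        vertical_axis (iso_center g) `<=` hplane_set (Vertical v) /\
        act g = hreflection (Vertical v) \o gamma1 g].

(* The parameters of R_g are not unique, but the plane is: see [R_planeP] and
   [R_plane_unique] below. *)
Definition R_plane (g : M2) : hplane R :=
  Vertical (xget (0, 1) (is_R_plane g)).

Definition gamma2 (g : M2) : H3 -> H3 := hreflection (R_plane g).

(* The reflections being involutions, this is the map completing the
   factorization g = gamma43 \o gamma2 \o gamma1: see [gamma_decomposition].
   It is a rotation about the vertical axis through the North pole of the
   isometric sphere of g^-1: see [gamma43_rotation]. *)
Definition gamma43 (g : M2) : H3 -> H3 := act g \o gamma1 g \o gamma2 g.

Lemma conjcM (x y : C) : conjc (x * y) = conjc x * conjc y.
Proof. exact: rmorphM. Qed.

Lemma conjcD (x y : C) : conjc (x + y) = conjc x + conjc y.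
Proof. exact: rmorphD. Qed.

Lemma conjcN (x : C) : conjc (- x) = - conjc x.
Proof. exact: rmorphN. Qed.

Lemma conjcV (x : C) : conjc (x^-1) = (conjc x)^-1.
Proof. exact: fmorphV. Qed.

Lemma real_complexM (x y : R) : (x * y)%:C = x%:C * y%:C.
Proof. exact: rmorphM. Qed.

Lemma real_complexD (x y : R) : (x + y)%:C = x%:C + y%:C.
Proof. exact: rmorphD. Qed.

Lemma real_complexV (x : R) : (x^-1)%:C = (x%:C)^-1.
Proof. exact: fmorphV. Qed.

Lemma cabsN (z : C) : cabs (- z) = cabs z.
Proof. by case: z => a b; rewrite /= !sqrrN. Qed.

Lemma hzE (z : C) (t : R) : 0 < t -> hz (mkH3 z t) = z.
Proof. by move=> t0; rewrite /hz /mkH3 insubdK. Qed.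

Lemma htE (z : C) (t : R) : 0 < t -> ht (mkH3 z t) = t.
Proof. by move=> t0; rewrite /ht /mkH3 insubdK. Qed.

Lemma ht_gt0 (x : H3) : 0 < ht x.
Proof. exact: (valP x). Qed.

Lemma H3_eq (x y : H3) : hz x = hz y -> ht x = ht y -> x = y.
Proof.
move=> zE tE; apply/val_inj/eqP.
by rewrite -pair_eqE; apply/andP; split; apply/eqP.
Qed.

Lemma cabs2C (z : C) : (cabs z ^+ 2)%:C = z * conjc z.
Proof. by rewrite -sqr_normc rmorphXn. Qed.

Lemma Re2C (z : C) : (2 * complex.Re z)%:C = z + conjc z.
Proof.
by case: z => a b; apply/eqP; rewrite eq_complex /= subrr mulr_natl mulr2n !eqxx.
Qed.

Lemma cabs_gt0 (z : C) : z != 0 -> 0 < cabs z.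
Proof. by move=> z0; rewrite -(@ltcR R) (_ : (cabs z)%:C = `|z|) // normr_gt0. Qed.

Lemma hz_vreflection (v : C * C) (x : H3) : v.2 <> 0 ->
  hz (hreflection (Vertical v) x) = v.1 - v.2 / conjc v.2 * conjc (hz x - v.1).
Proof.
move=> /eqP n0; rewrite /hreflection hzE ?ht_gt0 //.
set w := hz x - v.1.
have -> : (2 * complex.Re (conjc v.2 * w) / cabs v.2 ^+ 2)%:C
   = (conjc v.2 * w + v.2 * conjc w) / (v.2 * conjc v.2).
  by rewrite real_complexM real_complexV Re2C cabs2C conjcM conjcK.
have -> : hz x = w + v.1 by rewrite subrK.
have n0' : conjc v.2 != 0 by rewrite conjc_eq0.
by field; apply/andP.
Qed.

Lemma ht_vreflection (v : C * C) (x : H3) :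
  ht (hreflection (Vertical v) x) = ht x.
Proof. by rewrite /= htE ?ht_gt0. Qed.

Lemma det_mx2 (g : M2) : \det g = g 0 0 * g 1 1 - g 0 1 * g 1 0.
Proof.
have l1 (i : 'I_1) : lift ord0 i = 1 :> 'I_2 by rewrite ord1; apply/val_inj.
have l0 (i : 'I_1) : lift (1 : 'I_2) i = 0 by rewrite ord1; apply/val_inj.
rewrite (expand_det_row _ ord0) big_ord_recl big_ord1 /cofactor !det_mx11 !mxE.
rewrite !l1 !l0 addn0 expr0 mul1r add0n.
by rewrite expr1 mulN1r mulrN.
Qed.

Lemma inv_mx2 (g : M2) : \det g = 1 ->
  (g^-1 1 0 = - g 1 0) * (g^-1 1 1 = g 0 0).
Proof.
rewrite det_mx2 => detE.
have ug : g \is a GRing.unit by rewrite unitmxE det_mx2 detE unitr1.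
have V : g^-1 * g = 1 by rewrite mulVr.
have E (i j : 'I_2) : g^-1 i 0 * g 0 j + g^-1 i 1 * g 1 j = (i == j)%:R.
  have := congr1 (fun m : M2 => m i j) V.
  rewrite !mxE big_ord_recl big_ord1.
  by rewrite (_ : lift ord0 ord0 = 1) //; apply/val_inj.
have e0 := E 1 0; have e1 := E 1 1.
rewrite (_ : (1 == 0 :> 'I_2) = false) // mulr0n in e0.
rewrite eqxx mulr1n in e1.
move: (g^-1 1 0) (g^-1 1 1) (g 0 0) (g 0 1) (g 1 0) (g 1 1) detE e0 e1.
move=> x y a b c d detE e0 e1; split.
  rewrite -[LHS]mulr1 -detE.
  transitivity (d * (x * a + y * c) - c * (x * b + y * d)); first by ring.
  by rewrite e0 e1 mulr0 mulr1 sub0r.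
rewrite -[LHS]mulr1 -detE.
transitivity (a * (x * b + y * d) - b * (x * a + y * c)); first by ring.
by rewrite e0 e1 mulr0 mulr1 subr0.
Qed.

Lemma iso_center_inv (g : M2) : \det g = 1 -> iso_center g^-1 = g 0 0 / g 1 0.
Proof.
by move=> dg; rewrite /iso_center !(inv_mx2 dg) invrN mulrNN.
Qed.

Lemma iso_radius_inv (g : M2) : \det g = 1 -> iso_radius g^-1 = iso_radius g.
Proof. by move=> dg; rewrite /iso_radius (inv_mx2 dg) cabsN. Qed.

Lemma act_denominator_gt0 (g : M2) (x : H3) : \det g = 1 ->
  0 < cabs (g 1 0 * hz x + g 1 1) ^+ 2 + cabs (g 1 0) ^+ 2 * ht x ^+ 2.
Proof.
move=> dg; have [c0|c0] := eqVneq (g 1 0) 0; last first.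
  by rewrite ltr_wpDl ?sqr_ge0 // mulr_gt0 // exprn_gt0 ?cabs_gt0 // ht_gt0.
apply: ltr_wpDr; first by rewrite mulr_ge0 // sqr_ge0.
apply/exprn_gt0/cabs_gt0.
rewrite c0 mul0r add0r; apply/eqP => d0; move: dg.
by rewrite det_mx2 c0 d0 !mulr0 subr0 => /esym/eqP; rewrite oner_eq0.
Qed.

Lemma actE (g : M2) (x : H3) : \det g = 1 -> g 1 0 != 0 ->
  hz (act g x) = iso_center g^-1
    - conjc (g 1 0) / g 1 0 * conjc (hz (gamma1 g x) - iso_center g)
  /\ ht (act g x) = ht (gamma1 g x).
Proof.
move=> dg c0; have D0 := act_denominator_gt0 x dg.
have t0 := ht_gt0 x.
have r0 : 0 < cabs (g 1 0) by apply: cabs_gt0.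
have E0 : 0 < cabs (hz x - iso_center g) ^+ 2 + ht x ^+ 2.
  by rewrite ltr_wpDl ?sqr_ge0 // exprn_gt0.
have k0 : 0 < iso_radius g ^+ 2 / (cabs (hz x - iso_center g) ^+ 2 + ht x ^+ 2).
  by rewrite divr_gt0 // exprn_gt0 // /iso_radius invr_gt0.
have DE : cabs (g 1 0 * hz x + g 1 1) ^+ 2 + cabs (g 1 0) ^+ 2 * ht x ^+ 2
  = cabs (g 1 0) ^+ 2 * (cabs (hz x - iso_center g) ^+ 2 + ht x ^+ 2).
  rewrite mulrDr; congr (_ + _); rewrite -exprMn -Normc.normcM /iso_center.
  by congr (cabs _ ^+ 2); field.
have Dt := divr_gt0 t0 D0; have kt := mulr_gt0 k0 t0.
rewrite /act /gamma1 /hreflection /iso_sphere /=.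
rewrite (hzE _ Dt) (hzE _ kt) (htE _ Dt) (htE _ kt).
split; last first.
  by rewrite DE /iso_radius; field; rewrite !gt_eqF.
rewrite DE iso_center_inv //.
move: E0 {k0 kt Dt D0 DE}; set E := cabs (hz x - iso_center g) ^+ 2 + ht x ^+ 2 => E0.
have EC : E%:C = (hz x - iso_center g) * conjc (hz x - iso_center g) + (ht x ^+ 2)%:C.
  by rewrite real_complexD cabs2C.
have E0' : E%:C != 0 by rewrite eq_complex /= eqxx andbT gt_eqF.
have addpK (A : C) : iso_center g + A - iso_center g = A.
  by rewrite addrAC subrr add0r.
rewrite addpK conjcM conjc_real.
rewrite [(cabs (g 1 0) ^+ 2 * E)%:C]real_complexM cabs2C.
have -> : (iso_radius g ^+ 2 / E)%:C = (g 1 0 * conjc (g 1 0))^-1 / E%:C.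
  by rewrite real_complexM real_complexV /iso_radius exprVn real_complexV cabs2C.
have -> : (ht x ^+ 2)%:C = E%:C - (hz x - iso_center g) * conjc (hz x - iso_center g).
  by rewrite EC addrAC subrr add0r.
clearbody E.
have dE := det_mx2 g; rewrite dg in dE.
have -> : g 0 1 = (g 0 0 * g 1 1 - 1) / g 1 0 by rewrite dE; field.
have cc0 : conjc (g 1 0) != 0 by rewrite conjc_eq0.
have -> : hz x = (hz x - iso_center g) + iso_center g by rewrite subrK.
rewrite !addrK; set w := hz x - _; clearbody w.
have -> : conjc (g 1 0 * (w + iso_center g) + g 1 1) = conjc (g 1 0) * conjc w.
  by rewrite -conjcM /iso_center; congr conjc; field.
rewrite /iso_center.
by field; rewrite c0 cc0 E0'.
Qed.

Lemma hreflection_fixed (v : C * C) (x : H3) : v.2 <> 0 ->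
  hreflection (Vertical v) x = x <-> hplane_set (Vertical v) x.
Proof.
move=> n0; have n0' : v.2 != 0 by apply/eqP.
have nn0 : conjc v.2 != 0 by rewrite conjc_eq0.
have key : (2 * hplane_eqn (Vertical v) x)%:C =
  conjc v.2 * (hz x - hz (hreflection (Vertical v) x)).
  rewrite hz_vreflection // /hplane_eqn Re2C conjcM conjcK.
  set w := hz x - v.1; have -> : hz x = w + v.1 by rewrite subrK.
  by clearbody w; field.
split=> [fx|px].
  move: key; rewrite fx subrr mulr0 => /eqP.
  rewrite eq_complex /= eqxx andbT mulf_eq0 pnatr_eq0 /= => /eqP.
  by [].
apply: H3_eq; last exact: ht_vreflection.
move: key; rewrite px mulr0 => /esym/eqP.
by rewrite mulf_eq0 (negbTE nn0) /= subr_eq0 => /eqP/esym.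
Qed.

Lemma cabs_conjc (z : C) : cabs (conjc z) = cabs z.
Proof. by case: z => a b; rewrite /= sqrrN. Qed.

Lemma cabs_eq0 (z : C) : (cabs z == 0) = (z == 0).
Proof.
apply/eqP/eqP => [|->]; [exact: Normc.eq0_normc | exact: Normc.normc0].
Qed.

Lemma cabs_divJ (n : C) : n != 0 -> cabs (n / conjc n) = 1.
Proof.
move=> n0; rewrite Normc.normcM Normc.normcV cabs_conjc divff //.
by rewrite cabs_eq0.
Qed.

Lemma vreflectionK (v : C * C) : v.2 <> 0 ->
  involutive (hreflection (Vertical v)).
Proof.
move=> n0 x; have n0' : v.2 != 0 by apply/eqP.
have nn0 : conjc v.2 != 0 by rewrite conjc_eq0.
apply: H3_eq; rewrite ?ht_vreflection // !hz_vreflection //.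
rewrite addrAC subrr add0r conjcN !conjcM conjcV !conjcK.
have -> : hz x = (hz x - v.1) + v.1 by rewrite subrK.
by rewrite addrK; set w := hz x - v.1; clearbody w; field; rewrite n0' nn0.
Qed.

Lemma hz_vreflection_swap (v : C * C) (p p' : C) (x : H3) : v.2 <> 0 ->
  p' = v.1 - v.2 / conjc v.2 * conjc (p - v.1) ->
  hz (hreflection (Vertical v) x) = p' - v.2 / conjc v.2 * conjc (hz x - p).
Proof.
move=> n0 ->; rewrite hz_vreflection // !conjcD !conjcN; ring.
Qed.

Lemma gamma1E (g : M2) (x : H3) : g 1 0 != 0 ->
  let k := iso_radius g ^+ 2 / (cabs (hz x - iso_center g) ^+ 2 + ht x ^+ 2) in
  [/\ 0 < k, hz (gamma1 g x) = iso_center g + k%:C * (hz x - iso_center g)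
    & ht (gamma1 g x) = k * ht x].
Proof.
move=> c0 k; have t0 := ht_gt0 x.
have r0 : 0 < iso_radius g by rewrite /iso_radius invr_gt0 cabs_gt0.
have E0 : 0 < cabs (hz x - iso_center g) ^+ 2 + ht x ^+ 2.
  by rewrite ltr_wpDl ?sqr_ge0 // exprn_gt0.
have k0 : 0 < k by rewrite divr_gt0 // exprn_gt0.
have kt := mulr_gt0 k0 t0.
by rewrite /gamma1 /hreflection /iso_sphere /= (hzE _ kt) (htE _ kt).
Qed.

Lemma gamma1K (g : M2) : g 1 0 != 0 -> involutive (gamma1 g).
Proof.
move=> c0 x; have [k0 hE tE] := gamma1E x c0.
have [_ hE' tE'] := gamma1E (gamma1 g x) c0.
move: hE' tE'; rewrite hE tE addrAC subrr add0r Normc.normcM.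
move: k0; set w := hz x - iso_center g.
set k := _ / (cabs w ^+ 2 + ht x ^+ 2) => k0.
have E0 : 0 < cabs w ^+ 2 + ht x ^+ 2.
  by rewrite ltr_wpDl ?sqr_ge0 // exprn_gt0 // ht_gt0.
have r0 : 0 < iso_radius g by rewrite /iso_radius invr_gt0 cabs_gt0.
have -> : cabs k%:C = k by rewrite /= expr0n addr0 sqrtr_sqr ger0_norm // ltW.
have -> : iso_radius g ^+ 2 / ((k * cabs w) ^+ 2 + (k * ht x) ^+ 2) = k^-1.
  by rewrite !exprMn -mulrDr /k; field; rewrite !gt_eqF.
have kn : k != 0 by rewrite gt_eqF.
clearbody k; rewrite [in X in X -> _]mulrA -real_complexM (mulVf kn) mul1r.
move=> hE' tE'; apply: H3_eq; first by rewrite hE' /w addrC subrK.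
by rewrite tE' mulKf.
Qed.

Lemma iso_sphere_eq (g : M2) : \det g = 1 -> g 1 0 != 0 ->
  hplane_set (iso_sphere g) = hplane_set (iso_sphere g^-1) <->
  iso_center g = iso_center g^-1.
Proof.
move=> dg c0; split=> [SE|pE]; last by rewrite /iso_sphere iso_radius_inv // pE.
have r0 : 0 < iso_radius g by rewrite /iso_radius invr_gt0 cabs_gt0.
have : hplane_set (iso_sphere g) (mkH3 (iso_center g) (iso_radius g)).
  by rewrite /hplane_set /= hzE ?htE // subrr Normc.normc0 expr0n add0r subrr.
rewrite SE /hplane_set /= hzE ?htE // iso_radius_inv // addrK => /eqP.
by rewrite sqrf_eq0 cabs_eq0 subr_eq0 => /eqP.
Qed.

Lemma vreflection_swapP (v : C * C) (g : M2) : \det g = 1 -> g 1 0 != 0 ->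
  v.2 <> 0 ->
  hreflection (Vertical v) @` hplane_set (iso_sphere g)
    = hplane_set (iso_sphere g^-1) <->
  iso_center g^-1 = v.1 - v.2 / conjc v.2 * conjc (iso_center g - v.1).
Proof.
move=> dg c0 n0; have n0' : v.2 != 0 by apply/eqP.
have nn0 : conjc v.2 != 0 by rewrite conjc_eq0.
have r0 : 0 < iso_radius g by rewrite /iso_radius invr_gt0 cabs_gt0.
split=> [SE|pE].
  pose N : H3 := mkH3 (iso_center g) (iso_radius g).
  have : hplane_set (iso_sphere g^-1) (hreflection (Vertical v) N).
    rewrite -SE; exists N => //.
    by rewrite /hplane_set /= hzE ?htE // subrr Normc.normc0 expr0n add0r subrr.
  rewrite /hplane_set /hplane_eqn /= -/(hreflection (Vertical v) N).
  rewrite ht_vreflection hz_vreflection // iso_radius_inv //.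
  rewrite /N hzE ?htE // addrK => /eqP.
  by rewrite sqrf_eq0 cabs_eq0 subr_eq0 => /eqP ->.
have sw x : hplane_set (iso_sphere g^-1) (hreflection (Vertical v) x) <->
            hplane_set (iso_sphere g) x.
  rewrite /hplane_set /hplane_eqn /= -/(hreflection (Vertical v) x).
  rewrite ht_vreflection (hz_vreflection_swap x n0 pE) iso_radius_inv //.
  rewrite (addrAC (iso_center g^-1)) subrr add0r cabsN Normc.normcM cabs_divJ // mul1r.
  by rewrite cabs_conjc.
apply/seteqP; split=> [_ [x Sx <-]|y Sy]; first exact/sw.
exists (hreflection (Vertical v) y); last exact: vreflectionK.
by apply/sw; rewrite vreflectionK.
Qed.

Lemma vertical_axis_subP (v : C * C) (z0 : C) : v.2 <> 0 ->
  vertical_axis z0 `<=` hplane_set (Vertical v) <->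
  z0 = v.1 - v.2 / conjc v.2 * conjc (z0 - v.1).
Proof.
move=> n0; have hz0 : hz (mkH3 z0 1) = z0 by rewrite hzE.
split=> [sub|zE x xz].
  have /(hreflection_fixed _ n0) fx := sub (mkH3 z0 1) hz0.
  by rewrite -[LHS]hz0 -fx hz_vreflection // hz0.
apply/(hreflection_fixed x n0); apply: H3_eq; last exact: ht_vreflection.
by rewrite hz_vreflection // xz.
Qed.

Lemma is_R_planeP (g : M2) (v : C * C) : \det g = 1 -> g 1 0 != 0 ->
  is_R_plane g v ->
  v.2 <> 0 /\
  iso_center g^-1 = v.1 - v.2 / conjc v.2 * conjc (iso_center g - v.1).
Proof.
move=> dg c0 [n0 neqS eqS]; split=> //.
have [SE|SNE] := pselect (hplane_set (iso_sphere g) = hplane_set (iso_sphere g^-1)).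
  have [/(vertical_axis_subP _ n0) pE _] := eqS SE.
  by rewrite -((iso_sphere_eq dg c0).1 SE).
by have [/(vreflection_swapP dg c0 n0)] := neqS SNE.
Qed.

Lemma is_R_plane_exists (g : M2) : \det g = 1 -> g 1 0 != 0 ->
  exists v, is_R_plane g v.
Proof.
move=> dg c0; have cc0 : conjc (g 1 0) != 0 by rewrite conjc_eq0.
have [pE|pN] := eqVneq (iso_center g) (iso_center g^-1).
  have n0 : (iso_center g, conjc (g 1 0)).2 <> 0 by apply/eqP.
  exists (iso_center g, conjc (g 1 0)); split=> //.
    by move/(_ ((iso_sphere_eq dg c0).2 pE)).
  move=> _; split.
    by apply/(vertical_axis_subP _ n0); rewrite /= subrr conjc0 mulr0 subr0.
  apply/funext => x; have [hE tE] := actE x dg c0.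
  apply: H3_eq.
    by rewrite hE -pE (hz_vreflection (gamma1 g x) n0) conjcK.
  by rewrite tE (ht_vreflection _ (gamma1 g x)).
set p := iso_center g in pN *; set p' := iso_center g^-1 in pN *.
have d0 : p' - p != 0 by rewrite subr_eq0 eq_sym.
have d0' : conjc p' - conjc p != 0.
  by rewrite -conjcN -conjcD conjc_eq0.
have n0 : ((p + p') / 2, p' - p).2 <> 0 by apply/eqP.
have two0 : (2 : C) != 0 by rewrite pnatr_eq0.
have hE : conjc ((p + p') / 2) = (conjc p + conjc p') / 2.
  by rewrite conjcM conjcD conjcV; congr (_ / _); exact: (conjc_nat _ 2).
have E1 : iso_center g^-1 = (p + p') / 2
    - (p' - p) / conjc (p' - p) * conjc (iso_center g - (p + p') / 2).
  rewrite -/p -/p' [conjc (p' - p)]conjcD [conjc (p - _)]conjcD !conjcN hE.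
  by field; exact: d0'.
have S1 := (vreflection_swapP dg c0 n0).2 E1.
exists ((p + p') / 2, p' - p); split=> //.
  move=> _; split=> //; rewrite -S1.
  apply/seteqP; split=> [_ [_ [x Sx <-] <-]|x Sx]; first by rewrite vreflectionK.
  by exists (hreflection (Vertical ((p + p') / 2, p' - p)) x);
    [exists x | exact: vreflectionK].
by move/(iso_sphere_eq dg c0).1/eqP; rewrite (negbTE pN).
Qed.

Lemma R_planeP (g : M2) : \det g = 1 -> g 1 0 != 0 ->
  exists2 v, R_plane g = Vertical v & is_R_plane g v.
Proof.
move=> dg c0; exists (xget (0, 1) (is_R_plane g)) => //.
apply: (@xgetPex _ (0, 1) (is_R_plane g)); exact: is_R_plane_exists.
Qed.

Lemma R_plane_unique (g : M2) (v : C * C) : \det g = 1 -> g 1 0 != 0 ->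
  is_R_plane g v -> hplane_set (Vertical v) = hplane_set (R_plane g).
Proof.
move=> dg c0 Rv; have [w -> Rw] := R_planeP dg c0.
suff rE : hreflection (Vertical v) = hreflection (Vertical w).
  have [nv _] := is_R_planeP dg c0 Rv; have [nw _] := is_R_planeP dg c0 Rw.
  apply/seteqP; split=> x.
    by move/(hreflection_fixed x nv); rewrite rE => /(hreflection_fixed x nw).
  by move/(hreflection_fixed x nw); rewrite -rE => /(hreflection_fixed x nv).
have [SE|SN] := pselect (hplane_set (iso_sphere g) = hplane_set (iso_sphere g^-1)).
  case: Rv => _ _ /(_ SE)[_ av]; case: Rw => _ _ /(_ SE)[_ aw].
  apply/funext => x; rewrite -(gamma1K c0 x).
  by rewrite -[LHS]/((hreflection _ \o gamma1 g) _) -av aw.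
have pN : iso_center g^-1 - iso_center g != 0.
  rewrite subr_eq0; apply/eqP => pE; apply: SN.
  exact/(iso_sphere_eq dg c0).
have pN' : conjc (iso_center g^-1 - iso_center g) != 0 by rewrite conjc_eq0.
have aE u : is_R_plane g u -> u.2 / conjc u.2 =
    (iso_center g^-1 - iso_center g) / conjc (iso_center g^-1 - iso_center g).
  move=> /(is_R_planeP dg c0)[/eqP n0 pE].
  have nn0 : conjc u.2 != 0 by rewrite conjc_eq0.
  apply: (mulIf pN'); rewrite [RHS]divfK //.
  have -> : iso_center g^-1 - iso_center g = - (iso_center g - u.1
      + u.2 / conjc u.2 * conjc (iso_center g - u.1)) by rewrite pE; ring.
  move: (iso_center g - u.1) => z.
  rewrite conjcN conjcD conjcM conjcK conjcM conjcV conjcK.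
  by field; rewrite n0 nn0.
apply/funext => x; apply: H3_eq; last by rewrite !ht_vreflection.
have [nv pv] := is_R_planeP dg c0 Rv; have [nw pw] := is_R_planeP dg c0 Rw.
by rewrite (hz_vreflection_swap x nv pv) (hz_vreflection_swap x nw pw) !aE.
Qed.

Lemma gamma_decomposition (g : M2) : \det g = 1 -> g 1 0 != 0 ->
  act g = gamma43 g \o gamma2 g \o gamma1 g.
Proof.
move=> dg c0; have [v vE Rv] := R_planeP dg c0.
have [n0 _] := is_R_planeP dg c0 Rv.
have g2 : involutive (gamma2 g) by rewrite /gamma2 vE; exact: vreflectionK.
apply/funext => x; rewrite -[RHS]/(act g (gamma1 g (gamma2 g (gamma2 g (gamma1 g x))))).
by rewrite g2 gamma1K.
Qed.

Lemma gamma43_rotation (g : M2) : \det g = 1 -> g 1 0 != 0 ->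
  exists2 u : C, cabs u = 1 & gamma43 g = vrotation (iso_center g^-1) u.
Proof.
move=> dg c0; have [v vE Rv] := R_planeP dg c0.
have [n0 pE] := is_R_planeP dg c0 Rv; have n0' : v.2 != 0 by apply/eqP.
have nn0 : conjc v.2 != 0 by rewrite conjc_eq0.
exists (conjc (g 1 0) / g 1 0 * conjc (v.2 / conjc v.2)).
  rewrite Normc.normcM cabs_conjc cabs_divJ // mulr1.
  by rewrite -{2}(conjcK (g 1 0)) cabs_divJ // conjc_eq0.
have gE : gamma2 g = hreflection (Vertical v) by rewrite /gamma2 vE.
apply/funext => x.
have [hE tE] := actE (gamma1 g (gamma2 g x)) dg c0.
rewrite gamma1K // gE in hE tE.
rewrite -[LHS]/(act g (gamma1 g (gamma2 g x))) gE; apply: H3_eq; last first.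
  by rewrite tE ht_vreflection htE // ht_gt0.
rewrite hE [RHS]hzE ?ht_gt0 //; move: (vreflectionK n0 x) => xE.
have -> : hz x = iso_center g^-1 - v.2 / conjc v.2 *
    conjc (hz (hreflection (Vertical v) x) - iso_center g).
  by rewrite -(hz_vreflection_swap _ n0 pE) xE.
move: (hz (hreflection _ x) - _) => z.
rewrite [conjc (v.2 / conjc v.2)]conjcM conjcV conjcK.
by field; rewrite c0 n0' nn0.
Qed.

End Kleinian.

(* Main.v *)
(* At a point x of the side P \cap g^-1 P both x and g x lie in P.  Reading P as a
   Ford domain puts x on the isometric sphere of g; reading it as the Dirichlet
   domain centered at w0 puts x at equal distance from w0 and g^-1 w0.  Since such
   points fill an open piece of a plane, either g^-1 w0 = w0, or the reflection
   gamma1 in the isometric sphere exchanges w0 and g^-1 w0.  In the first case g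
   would preserve P, so P would lie on the isometric sphere, although a Ford domain
   contains vertical rays.  Hence g gamma1, a height-preserving Euclidean isometry
   reversing the orientation of C, fixes w0: it is the reflection in a vertical
   plane through w0.  For the side-pairings fixing infinity, discreteness together
   with a parabolic element forces the derivative to have modulus 1. *)
Require Import Defs.
From HB Require Import structures.
From mathcomp Require Import all_boot all_order all_algebra.
From mathcomp Require Import complex ring lra.
From mathcomp Require Import all_classical all_reals all_analysis.

Set Implicit Arguments.
Unset Strict Implicit.
Unset Printing Implicit Defensive.

Import Order.TTheory GRing.Theory Num.Theory.
Local Open Scope classical_set_scope.
Local Open Scope ring_scope.

(** * Comparing hyperbolic distances through their hyperbolic cosine *)

Section HyperbolicDistance.
Local Open Scope complex_scope.
Variable R : realType.
Local Notation C := R[i].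
Local Notation H3 := (H3 R).

Lemma cabs_sqr (z : C) : cabs z ^+ 2 = complex.Re z ^+ 2 + complex.Im z ^+ 2.
Proof. by case: z => a b /=; rewrite sqr_sqrtr // addr_ge0 ?sqr_ge0. Qed.

Lemma cabs_ge0 (z : C) : 0 <= cabs z.
Proof. by case: z => a b /=; exact: sqrtr_ge0. Qed.

(* [cosh (hdist x y) - 1] *)
Definition hcoshm1 (x y : H3) : R :=
  (cabs (hz x - hz y) ^+ 2 + (ht x - ht y) ^+ 2) / (2 * ht x * ht y).

Lemma hcoshm1_ge0 (x y : H3) : 0 <= hcoshm1 x y.
Proof.
rewrite /hcoshm1 divr_ge0 //; first by rewrite addr_ge0 ?sqr_ge0.
by rewrite !mulr_ge0 // ltW // ht_gt0.
Qed.

(** The function ln (u + sqrt (u^2 - 1)) is increasing for u >= 1, so distances compare as the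
    rational expressions [hcoshm1] do. *)
Lemma hdist_le (x y x' y' : H3) :
  (hdist x y <= hdist x' y') = (hcoshm1 x y <= hcoshm1 x' y').
Proof.
rewrite /hdist -/(hcoshm1 x y) -/(hcoshm1 x' y').
have := hcoshm1_ge0 x y; have := hcoshm1_ge0 x' y'.
move: (hcoshm1 x y) (hcoshm1 x' y') => u v v0 u0.
have pos (w : R) : 0 <= w -> 0 < 1 + w + Num.sqrt ((1 + w) ^+ 2 - 1).
  by move=> w0; rewrite ltr_wpDr ?sqrtr_ge0 // ltr_wpDr.
have mono (a b : R) : 0 <= a -> a < b ->
    1 + a + Num.sqrt ((1 + a) ^+ 2 - 1) < 1 + b + Num.sqrt ((1 + b) ^+ 2 - 1).
  move=> a0 ab; apply: ltr_leD; first by rewrite ltrD2l.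
  apply: ler_wsqrtr; nra.
rewrite ler_ln ?posrE ?pos //.
have [uv|vu] := leP u v.
  by apply/idP; move: uv; rewrite le_eqVlt => /predU1P[->//|/(mono _ _ u0)/ltW].
by apply/negbTE; rewrite -ltNge mono.
Qed.

Lemma hdist_eq (x y x' y' : H3) :
  hcoshm1 x y = hcoshm1 x' y' -> hdist x y = hdist x' y'.
Proof. by move=> e; apply/eqP; rewrite eq_le !hdist_le e lexx. Qed.

Lemma hdist_eqP (x y x' y' : H3) :
  hdist x y = hdist x' y' <-> hcoshm1 x y = hcoshm1 x' y'.
Proof.
split=> [/eqP|]; last exact: hdist_eq.
by rewrite eq_le !hdist_le -eq_le => /eqP.
Qed.

Lemma hdist_small (e : R) : 0 < e -> exists2 d : R, 0 < d &
  forall x y : H3, hcoshm1 x y < d -> hdist x y < e.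
Proof.
move=> e0; have E1 : 1 < expR e by rewrite expR_gt1.
have E0 : 0 < 2 * expR e by rewrite mulr_gt0 ?expR_gt0.
(* This constant is cosh e - 1. *)
exists ((expR e - 1) ^+ 2 / (2 * expR e)).
  by rewrite divr_gt0 // exprn_gt0 // subr_gt0.
move=> x y; rewrite /hdist -/(hcoshm1 x y).
have := hcoshm1_ge0 x y; move: (hcoshm1 x y) => v v0 vd.
move: vd; rewrite ltr_pdivlMr // => vd.
have w0 : 0 < expR e - (1 + v) by nra.
have pos : 0 < 1 + v + Num.sqrt ((1 + v) ^+ 2 - 1).
  by rewrite ltr_wpDr ?sqrtr_ge0 // ltr_wpDr.
rewrite -[ltRHS]expRK ltr_ln ?posrE ?expR_gt0 //.
rewrite -ltrBrDl -(ger0_norm (ltW w0)) -sqrtr_sqr ltr_sqrt ?exprn_gt0 //.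
nra.
Qed.

End HyperbolicDistance.

(** * The action of SL_2(C) on upper half-space *)

Section Action.
Local Open Scope complex_scope.
Variable R : realType.
Local Notation C := R[i].
Local Notation H3 := (H3 R).
Local Notation M2 := 'M[C]_2.

Lemma mulmx2E (g h : M2) (i j : 'I_2) :
  (g * h) i j = g i 0 * h 0 j + g i 1 * h 1 j.
Proof.
rewrite !mxE big_ord_recl big_ord1.
by rewrite (_ : lift ord0 ord0 = 1) //; apply/val_inj.
Qed.

Lemma real_complexX (x : R) n : (x ^+ n)%:C = x%:C ^+ n.
Proof. exact: rmorphXn. Qed.

Lemma conjcX (z : C) n : conjc (z ^+ n) = conjc z ^+ n.
Proof. exact: rmorphXn. Qed.

Lemma hz_act (g : M2) (x : H3) : \det g = 1 ->
  hz (act g x) = ((g 0 0 * hz x + g 0 1) * conjc (g 1 0 * hz x + g 1 1)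
      + g 0 0 * conjc (g 1 0) * (ht x)%:C ^+ 2)
    / ((g 1 0 * hz x + g 1 1) * conjc (g 1 0 * hz x + g 1 1)
      + g 1 0 * conjc (g 1 0) * (ht x)%:C ^+ 2).
Proof.
move=> dg; have D0 := act_denominator_gt0 x dg.
rewrite /act hzE; last exact: divr_gt0 (ht_gt0 x) D0.
by rewrite real_complexD [(_ * ht x ^+ 2)%:C]real_complexM !cabs2C !real_complexX.
Qed.

Lemma ht_act (g : M2) (x : H3) : \det g = 1 ->
  (ht (act g x))%:C = (ht x)%:C
    / ((g 1 0 * hz x + g 1 1) * conjc (g 1 0 * hz x + g 1 1)
      + g 1 0 * conjc (g 1 0) * (ht x)%:C ^+ 2).
Proof.
move=> dg; have D0 := act_denominator_gt0 x dg.
rewrite /act htE; last exact: divr_gt0 (ht_gt0 x) D0.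
by rewrite real_complexM real_complexV real_complexD [(_ * ht x ^+ 2)%:C]real_complexM
  !cabs2C !real_complexX.
Qed.

Lemma act_denominator_neq0 (g : M2) (x : H3) : \det g = 1 ->
  (g 1 0 * hz x + g 1 1) * conjc (g 1 0 * hz x + g 1 1)
      + g 1 0 * conjc (g 1 0) * (ht x)%:C ^+ 2 != 0.
Proof.
move=> dg; have D0 := act_denominator_gt0 x dg.
rewrite -!cabs2C -real_complexX -real_complexM -real_complexD.
by rewrite eq_complex /= eqxx andbT gt_eqF.
Qed.

(** Numerator and denominator in [hz_act] are values of one sesquilinear form on pairs of rows.
    Applying [h] first multiplies the rows by [h] on the right and divides the form by the
    denominator [D] of [act h x]; this is [qE]. *)
Lemma actM (g h : M2) (x : H3) : \det g = 1 -> \det h = 1 ->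
  act (g * h) x = act g (act h x).
Proof.
move=> dg dh; have dgh : \det (g * h) = 1 by rewrite det_mulmx dg dh mulr1.
have D1 := act_denominator_neq0 x dgh.
have D2 := act_denominator_neq0 (act h x) dg.
have D3 := act_denominator_neq0 x dh.
have dE := dh; rewrite det_mx2 in dE.
have dE' := congr1 (@conjc R) dE.
rewrite conjcD conjcN !conjcM conjc1 in dE'.
set z := hz x; set t := ht x in D1 D3 *.
rewrite -/z in D1 D3.
pose N := (h 0 0 * z + h 0 1) * conjc (h 1 0 * z + h 1 1)
  + h 0 0 * conjc (h 1 0) * t%:C ^+ 2.
pose N' := conjc (h 0 0 * z + h 0 1) * (h 1 0 * z + h 1 1)
  + conjc (h 0 0) * h 1 0 * t%:C ^+ 2.
pose D := (h 1 0 * z + h 1 1) * conjc (h 1 0 * z + h 1 1)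
  + h 1 0 * conjc (h 1 0) * t%:C ^+ 2.
have zE : hz (act h x) = N / D by rewrite hz_act.
have tE : (ht (act h x))%:C = t%:C / D by rewrite ht_act.
have zcE : conjc (hz (act h x)) = N' / D.
  rewrite zE conjcM conjcV /N /N' /D !(conjcD, conjcM, conjcK, conjcX) !conjc_real.
  by congr (_ / _); ring.
(* The inserted factor, det h times its conjugate, equals 1; it turns [qE] into a rational identity
   with free entries of [h]. *)
have t2E : (ht (act h x))%:C ^+ 2 = t%:C ^+ 2 / D ^+ 2
    * ((h 0 0 * h 1 1 - h 0 1 * h 1 0)
      * (conjc (h 0 0) * conjc (h 1 1) - conjc (h 0 1) * conjc (h 1 0))).
  by rewrite tE dE dE' !mulr1 exprMn exprVn.
have qE (p q p' q' : C) :
    (p * hz (act h x) + q) * conjc (p' * hz (act h x) + q')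
      + p * conjc p' * (ht (act h x))%:C ^+ 2
    = (((p * h 0 0 + q * h 1 0) * z + (p * h 0 1 + q * h 1 1)) *
       conjc ((p' * h 0 0 + q' * h 1 0) * z + (p' * h 0 1 + q' * h 1 1))
      + (p * h 0 0 + q * h 1 0) * conjc (p' * h 0 0 + q' * h 1 0) * t%:C ^+ 2) / D.
  rewrite t2E [conjc (p' * hz _ + q')]conjcD [conjc (p' * hz _)]conjcM zcE zE.
  move: D3; rewrite /N /N' /D !(conjcD, conjcM); clear; move=> D3.
  by field.
have D3' : D != 0 by [].
apply: H3_eq.
  rewrite (hz_act _ dg) (hz_act _ dgh) !qE !mulmx2E -/z -/t.
  move: D1; rewrite !mulmx2E => D1.
  by rewrite -mulf_div divff ?mulr1 // invr_neq0.
apply: complexI; rewrite (ht_act _ dg) (ht_act _ dgh) qE tE !mulmx2E -/z -/t.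
by rewrite -mulf_div divff ?mulr1 // invr_neq0.
Qed.

Lemma act_trivial (g : M2) (x : H3) : psl_trivial g -> act g x = x.
Proof.
move=> tg.
have [e [e2 ee] [e00 e01 e10 e11]] : exists2 e : C, e * e = 1 /\ e * conjc e = 1 &
    [/\ g 0 0 = e, g 0 1 = 0, g 1 0 = 0 & g 1 1 = e].
  by case: tg => ->; [exists 1 | exists (-1)];
    rewrite ?conjcN ?conjc1 ?mulrNN ?mulr1 // !mxE /= ?oppr0.
have dg : \det g = 1 by rewrite det_mx2 e00 e01 e10 e11 mul0r subr0.
apply: H3_eq; last apply: complexI.
  rewrite hz_act // e00 e01 e10 e11 conjcD conjcM conjc0.
  by rewrite !(mul0r, mulr0, addr0, add0r) ee divr1 mulrAC ee mul1r.
rewrite ht_act // e10 e11 conjcD conjcM conjc0.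
by rewrite !(mul0r, mulr0, addr0, add0r) ee divr1.
Qed.

Lemma det1_inv (g : M2) : \det g = 1 -> \det g^-1 = 1.
Proof. by move=> dg; rewrite det_inv dg invr1. Qed.

Lemma actVK (g : M2) : \det g = 1 -> cancel (act g^-1) (act g).
Proof.
move=> dg x; rewrite -actM ?det1_inv // divrr ?act_trivial //; first by left.
by rewrite unitmxE dg unitr1.
Qed.

Lemma actK (g : M2) : \det g = 1 -> cancel (act g) (act g^-1).
Proof.
move=> dg x; rewrite -actM ?det1_inv // mulVr ?act_trivial //; first by left.
by rewrite unitmxE dg unitr1.
Qed.

Lemma cabs_conj_mul_div (c z : C) : c != 0 -> cabs (conjc c / c * conjc z) = cabs z.
Proof.
move=> c0; rewrite Normc.normcM cabs_conjc -{2}(conjcK c) cabs_divJ ?mul1r //.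
by rewrite conjc_eq0.
Qed.

(** Inversion multiplies the two heights by factors k and l, and the squared Euclidean distance by k
    l, so the quotient is unchanged. *)
Lemma hcoshm1_gamma1 (g : M2) (x y : H3) : g 1 0 != 0 ->
  hcoshm1 (gamma1 g x) (gamma1 g y) = hcoshm1 x y.
Proof.
move=> c0; have [k0 hE tE] := gamma1E x c0; have [l0 hE' tE'] := gamma1E y c0.
rewrite /hcoshm1 hE hE' tE tE'.
have r0 : 0 < iso_radius g by rewrite /iso_radius invr_gt0 cabs_gt0.
have tx := ht_gt0 x; have ty := ht_gt0 y.
have -> (A B p : C) : p + A - (p + B) = A - B by ring.
have -> : hz x - hz y = (hz x - iso_center g) - (hz y - iso_center g) by ring.
have E0 : 0 < cabs (hz x - iso_center g) ^+ 2 + ht x ^+ 2.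
  by rewrite ltr_wpDl ?sqr_ge0 // exprn_gt0.
have E0' : 0 < cabs (hz y - iso_center g) ^+ 2 + ht y ^+ 2.
  by rewrite ltr_wpDl ?sqr_ge0 // exprn_gt0.
move: k0 l0 r0 tx ty E0 E0' => _ _.
move: (hz x - _) (hz y - _) (ht x) (ht y) (iso_radius g) => u w s t r.
rewrite !cabs_sqr => r0 s0 t0.
case: u w => [a b] [a' b'] /= E0 E0'.
rewrite !(mul0r, subr0, addr0, add0r).
by field; rewrite !gt_eqF.
Qed.

(** By [actE], [act g] is [gamma1 g] followed by a Euclidean isometry that keeps heights. *)
Lemma hdist_act (g : M2) (x y : H3) : \det g = 1 -> g 1 0 != 0 ->
  hdist (act g x) (act g y) = hdist x y.
Proof.
move=> dg c0; apply: hdist_eq; rewrite -(hcoshm1_gamma1 x y c0) /hcoshm1.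
have [-> ->] := actE x dg c0; have [-> ->] := actE y dg c0.
congr (_ / _); congr (_ ^+ 2 + _).
rewrite -(cabs_conj_mul_div (hz (gamma1 g x) - _) c0) -cabsN; congr cabs.
rewrite !conjcD !conjcN; ring.
Qed.

End Action.

(** * Nearby points within a plane, and bisectors containing a piece of a hemisphere *)

Section Patches.
Local Open Scope complex_scope.
Variable R : realType.
Local Notation C := R[i].
Local Notation H3 := (H3 R).

Lemma hcoshm1E (x y : H3) : hcoshm1 x y =
  ((complex.Re (hz x) - complex.Re (hz y)) ^+ 2
   + (complex.Im (hz x) - complex.Im (hz y)) ^+ 2
   + (ht x - ht y) ^+ 2) / (2 * ht x * ht y).
Proof.
by rewrite /hcoshm1 cabs_sqr; case: (hz x) (hz y) => [a b] [a' b'].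
Qed.

Lemma hemisphere_eqnE (p : C) (r : R) (x : H3) :
  hplane_eqn (Hemisphere (p, r)) x =
  (complex.Re (hz x) - complex.Re p) ^+ 2
  + (complex.Im (hz x) - complex.Im p) ^+ 2 + ht x ^+ 2 - r ^+ 2.
Proof.
by rewrite /hplane_eqn /= cabs_sqr; case: (hz x) p => [a b] [a' b'].
Qed.

(** A hemisphere meets a vertical line at most once, so this point above [x] rules out vertical
    supporting planes in [side_in_hemisphere_points]. *)
Lemma vertical_patch (v : C * C) (x : H3) (e : R) :
  hplane_set (Vertical v) x -> 0 < e ->
  exists y, [/\ hplane_set (Vertical v) y, hdist x y < e,
    hz y = hz x & ht x < ht y].
Proof.
move=> vx /(@hdist_small R)[d d0 dP]; have t0 := ht_gt0 x.
(* These bounds give s^2 <= s <= d t^2, which is below d times the denominator 2 t (t + s) of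
   [hcoshm1]. *)
pose s := Num.min 1 (d * ht x ^+ 2).
have s0 : 0 < s by rewrite lt_min ltr01 mulr_gt0 // exprn_gt0.
have s1 : s <= 1 by rewrite ge_min lexx.
have sd : s <= d * ht x ^+ 2 by rewrite ge_min lexx orbT.
have ts : 0 < ht x + s by rewrite addr_gt0.
exists (mkH3 (hz x) (ht x + s)); rewrite hzE // htE //; split=> //; last by rewrite ltrDl.
  by rewrite /hplane_set /hplane_eqn /= hzE.
apply: dP; rewrite hcoshm1E hzE // htE //.
rewrite ltr_pdivrMr; last by rewrite !mulr_gt0.
rewrite !subrr expr0n !add0r opprD addNKr sqrrN.
have ss : s ^+ 2 <= s by rewrite expr2 ler_piMr // ltW.
apply: le_lt_trans ss (le_lt_trans sd _).
by rewrite ltr_pM2l //; nra.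
Qed.

(** A single horizontal step length [m] serves all directions; the new height then solves the
    equation of the hemisphere. *)
Lemma hemisphere_patch (p : C) (r : R) (x : H3) (e : R) :
  hplane_set (Hemisphere (p, r)) x -> 0 < e ->
  exists2 m : R, 0 < m &
    forall c d : R, c ^+ 2 + d ^+ 2 = 1 ->
    exists y, [/\ hplane_set (Hemisphere (p, r)) y, hdist x y < e
      & hz y = hz x + m%:C * (c +i* d)].
Proof.
move=> + /(@hdist_small R)[D D0 DP]; have t0 := ht_gt0 x.
rewrite /hplane_set -[_ x]/(hplane_eqn (Hemisphere (p, r)) x = 0) hemisphere_eqnE.
set t := ht x in t0 *; set a := complex.Re (hz x) - _; set b := complex.Im (hz x) - _.
move=> xS; set K := a ^+ 2 + b ^+ 2 + 2.
have K0 : 2 <= K by rewrite /K; nra.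
have K0' : 0 < K by lra.
have t20 : 0 < t ^+ 2 by rewrite exprn_gt0.
have Q0 : 0 < 2 * (t ^+ 2 + K ^+ 2) by nra.
(* With [M] below the drop in squared height, the bound 1 gives |M| <= m K, the second gives s^2 >=
   t^2 / 2, and the third keeps the new point within distance [e]. *)
pose m := Num.min (Num.min 1 (t ^+ 2 / (2 * K)))
                  (D * t ^+ 4 / (2 * (t ^+ 2 + K ^+ 2))).
have m0 : 0 < m.
  by rewrite !lt_min ltr01 !divr_gt0 // mulr_gt0 // exprn_gt0.
have m1 : m <= 1 by rewrite !ge_min lexx.
have m2 : m * (2 * K) <= t ^+ 2.
  by rewrite -ler_pdivlMr ?mulr_gt0 // !ge_min lexx orbT.
have m3 : m * (2 * (t ^+ 2 + K ^+ 2)) <= D * t ^+ 4.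
  by rewrite -ler_pdivlMr // !ge_min lexx orbT.
move: (m) m0 m1 m2 m3 => {}m m0 m1 m2 m3; exists m => // c d cd.
set M := 2 * m * (a * c + b * d) + m ^+ 2.
have Mle : `|M| <= m * K.
  have -> : M = m * (2 * (a * c + b * d) + m) by rewrite /M; ring.
  rewrite normrM gtr0_norm // ler_pM2l // ler_norml /K.
  have := sqr_ge0 (a - c); have := sqr_ge0 (b - d).
  have := sqr_ge0 (a + c); have := sqr_ge0 (b + d).
  by rewrite !sqrrD !sqrrN => *; apply/andP; split; lra.
have /andP[M1 M2] : - (m * K) <= M <= m * K by rewrite -ler_norml.
pose s := Num.sqrt (t ^+ 2 - M).
have sE : s ^+ 2 = t ^+ 2 - M by rewrite sqr_sqrtr //; lra.
have s0 : 0 < s by rewrite sqrtr_gt0; lra.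
have st : t <= 2 * s by nra.
have [ReE ImE] : complex.Re (hz x + m%:C * (c +i* d)) = complex.Re (hz x) + m * c /\
    complex.Im (hz x + m%:C * (c +i* d)) = complex.Im (hz x) + m * d.
  by case: (hz x) => ? ?; split => /=; ring.
exists (mkH3 (hz x + m%:C * (c +i* d)) s); split; last by rewrite hzE.
  rewrite /hplane_set -[_ _]/(hplane_eqn (Hemisphere (p, r)) _ = 0).
  rewrite hemisphere_eqnE hzE // htE // sE /M.
  rewrite ReE ImE -[RHS]xS /M /a /b.
  have -> : m ^+ 2 = m ^+ 2 * (c ^+ 2 + d ^+ 2) by rewrite cd mulr1.
  ring.
apply: DP; rewrite hcoshm1E hzE // htE // -/t.
rewrite ltr_pdivrMr; last by rewrite !mulr_gt0.
rewrite ReE ImE !opprD !addNKr !sqrrN !exprMn -mulrDr cd mulr1.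
(* From (t - s) (t + s) = M follows |t - s| t <= |M| <= m K. *)
have dif : (t - s) ^+ 2 * t ^+ 2 <= (m * K) ^+ 2.
  have -> : (m * K) ^+ 2 = `|m * K| ^+ 2 by rewrite real_normK ?num_real.
  rewrite -exprMn -(@real_normK _ ((t - s) * t)) ?num_real // lerXn2r ?nnegrE ?normr_ge0 //.
  rewrite (ger0_norm (ltW (mulr_gt0 m0 K0'))); apply: le_trans Mle.
  have -> : M = (t - s) * (t + s) by rewrite -[M](subKr (t ^+ 2)) -sE; ring.
  rewrite !normrM ler_wpM2l // !gtr0_norm ?addr_gt0 // lerDl ltW //.
rewrite -(ltr_pM2r t20).
have h1 : (m ^+ 2 + (t - s) ^+ 2) * t ^+ 2 <= m * (m * (t ^+ 2 + K ^+ 2)).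
  have -> : m * (m * (t ^+ 2 + K ^+ 2)) = m ^+ 2 * t ^+ 2 + (m * K) ^+ 2 by ring.
  by rewrite mulrDl lerD2l.
apply: le_lt_trans h1 _.
have h2 : 0 < m * (t ^+ 2 + K ^+ 2) by rewrite mulr_gt0 //; lra.
have h3 : D * (2 * t * s) * t ^+ 2 >= D * t ^+ 4.
  have -> : D * (2 * t * s) * t ^+ 2 = (D * t ^+ 3) * (2 * s) by ring.
  have -> : D * t ^+ 4 = (D * t ^+ 3) * t by ring.
  by rewrite ler_wpM2l // mulr_ge0 // ltW // exprn_gt0.
nra.
Qed.

(** The supporting plane cannot be vertical, so short steps from [x] in the directions 1 and i stay
    in the side. The three projections to C are affinely independent, as the bisector argument
    requires. *)
Lemma side_in_hemisphere_points (Q F : set H3) (p : C) (r : R) :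
  is_side Q F -> F `<=` hplane_set (Hemisphere (p, r)) ->
  exists x y1 y2 : H3, exists2 m : R, 0 < m &
    [/\ F x, F y1, F y2, hz y1 = hz x + m%:C & hz y2 = hz x + m%:C * 'i].
Proof.
move=> [[h b] [/= vh _ FE [x [e [Fx e0 xP]]]]] FS.
have hx : hplane_set h x by move: Fx; rewrite FE => -[].
case: h => [v|[p' r']] in vh FE xP hx *.
  have [y [vy xy zE xt]] := vertical_patch hx e0.
  have := FS _ Fx; have := FS _ (xP _ vy xy).
  rewrite /hplane_set -![[set _ | _] _]/(hplane_eqn _ _ = 0) !hemisphere_eqnE zE => Sx Sy.
  have sq : ht y ^+ 2 = ht x ^+ 2 by lra.
  by have := ht_gt0 x; nra.
have [m m0 mP] := hemisphere_patch hx e0.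
have [y1 [hy1 d1 z1]] := mP 1 0 ltac:(rewrite expr1n expr0n addr0 //).
have [y2 [hy2 d2 z2]] := mP 0 1 ltac:(rewrite expr1n expr0n add0r //).
exists x, y1, y2, m => //; split=> //; [exact: xP | exact: xP |].
by rewrite z1 (_ : 1 +i* 0 = 1) // mulr1.
Qed.

(** On the hemisphere |y - p|^2 = r^2, so being equidistant from [w0] and [w1] is an affine
    condition on [hz y]. Three affinely independent solutions make all its coefficients vanish. *)
Lemma bisector_hemisphere_center (p : C) (r m : R) (x y1 y2 w0 w1 : H3) :
  0 < m -> hz y1 = hz x + m%:C -> hz y2 = hz x + m%:C * 'i ->
  (forall y, y \in [:: x; y1; y2] ->
     hplane_set (Hemisphere (p, r)) y /\ hdist y w0 = hdist y w1) ->
  w1 = w0 \/ w1 = hreflection (Hemisphere (p, r)) w0.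
Proof.
move=> m0 z1 z2 yP.
have t0 := ht_gt0 w0; have t1 := ht_gt0 w1.
pose a y := complex.Re (hz y) - complex.Re p.
pose b y := complex.Im (hz y) - complex.Im p.
have E y : y \in [:: x; y1; y2] ->
    ht w1 * (r ^+ 2 - 2 * (a y * a w0 + b y * b w0)
             + (a w0 ^+ 2 + b w0 ^+ 2 + ht w0 ^+ 2))
  = ht w0 * (r ^+ 2 - 2 * (a y * a w1 + b y * b w1)
             + (a w1 ^+ 2 + b w1 ^+ 2 + ht w1 ^+ 2)).
  move=> /yP[]; rewrite /hplane_set -[_ y]/(hplane_eqn (Hemisphere (p, r)) y = 0).
  rewrite hemisphere_eqnE -/(a y) -/(b y) => Sy /hdist_eqP; rewrite !hcoshm1E.
  have ty := ht_gt0 y.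
  have dE w : complex.Re (hz y) - complex.Re (hz w) = a y - a w by rewrite /a; ring.
  have dE' w : complex.Im (hz y) - complex.Im (hz w) = b y - b w by rewrite /b; ring.
  have n0 : 2 * ht y * ht w0 != 0 by rewrite gt_eqF ?mulr_gt0.
  have n1 : 2 * ht y * ht w1 != 0 by rewrite gt_eqF ?mulr_gt0.
  rewrite !dE !dE' => /eqP; rewrite eqr_div // => /eqP H.
  have rE : r ^+ 2 = a y ^+ 2 + b y ^+ 2 + ht y ^+ 2 by lra.
  rewrite rE; apply: (@mulfI _ (2 * ht y)); first by rewrite gt_eqF ?mulr_gt0.
  move: H; move: (a y) (b y) (a w0) (a w1) (b w0) (b w1) (ht y) (ht w0) (ht w1).
  clear => ay by_ a0 a1 b0 b1 t t0 t1 H.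
  lra.
have Ex := E x ltac:(by rewrite !inE eqxx).
have E1 := E y1 ltac:(by rewrite !inE eqxx orbT).
have E2 := E y2 ltac:(by rewrite !inE eqxx !orbT).
have [a1 b1] : a y1 = a x + m /\ b y1 = b x.
  by rewrite /a /b z1; case: (hz x) => ? ? /=; split; ring.
have [a2 b2] : a y2 = a x /\ b y2 = b x + m.
  by rewrite /a /b z2; case: (hz x) => ? ? /=; split; ring.
rewrite a1 b1 in E1; rewrite a2 b2 in E2.
(* Subtracting the equation at [x] from those at [y1] and [y2] shows, with [bE], that [w0] and [w1]
   lie on one ray from the center. *)
have aE : ht w1 * a w0 = ht w0 * a w1.
  apply: (@mulfI _ m); first by rewrite gt_eqF.
  lra.
have bE : ht w1 * b w0 = ht w0 * b w1.
  apply: (@mulfI _ m); first by rewrite gt_eqF.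
  lra.
set N := a w0 ^+ 2 + b w0 ^+ 2 + ht w0 ^+ 2.
have N0 : 0 < N by rewrite /N ltr_wpDl ?exprn_gt0 // addr_ge0 ?sqr_ge0.
(* The constant term factors: the first factor vanishes when w1 = w0, the second when [w1] is the
   inversion of [w0]. *)
have prod0 : (ht w1 - ht w0) * (ht w1 * N - ht w0 * r ^+ 2) = 0.
  have -> : (ht w1 - ht w0) * (ht w1 * N - ht w0 * r ^+ 2) =
    (ht w1 * a w0) ^+ 2 + (ht w1 * b w0) ^+ 2 + (ht w0 * ht w1) ^+ 2
    + ht w0 ^+ 2 * r ^+ 2 - ht w0 * (ht w1 * (r ^+ 2 + N)) by rewrite /N; ring.
  have -> : ht w1 * (r ^+ 2 + N) = ht w0 * (r ^+ 2 +
      (a w1 ^+ 2 + b w1 ^+ 2 + ht w1 ^+ 2)).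
    have c1 : ht w1 * (2 * (a x * a w0)) = ht w0 * (2 * (a x * a w1)).
      by rewrite !(mulrCA _ 2) !(mulrCA _ (a x)) aE.
    have c2 : ht w1 * (2 * (b x * b w0)) = ht w0 * (2 * (b x * b w1)).
      by rewrite !(mulrCA _ 2) !(mulrCA _ (b x)) bE.
    by move: Ex; rewrite -/N => H; lra.
  by rewrite aE bE; ring.
have eqw (w : H3) : ht w = ht w1 -> complex.Re (hz w) - complex.Re p = a w1 ->
    complex.Im (hz w) - complex.Im p = b w1 -> w1 = w.
  rewrite /a /b => tE /addIr rE /addIr iE; apply: H3_eq => //.
  by move: rE iE; case: (hz w) (hz w1) => ? ? [? ?] /= -> ->.
move/eqP: prod0; rewrite mulf_eq0 => /orP[/eqP tt|/eqP tN]; [left|right].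
  have tE : ht w0 = ht w1 by lra.
  apply: eqw => //; apply: (@mulfI _ (ht w0)); rewrite ?gt_eqF //.
    by rewrite -aE tE.
  by rewrite -bE tE.
have kE : r ^+ 2 / (cabs (hz w0 - p) ^+ 2 + ht w0 ^+ 2) = ht w1 / ht w0.
  have -> : cabs (hz w0 - p) ^+ 2 + ht w0 ^+ 2 = N.
    by rewrite cabs_sqr /N /a /b; clear; case: (hz w0) p => [? ?] [? ?].
  have n0 : N != 0 by rewrite gt_eqF.
  have n1 : ht w0 != 0 by rewrite gt_eqF.
  by apply/eqP; rewrite eqr_div //; apply/eqP; lra.
rewrite /= kE divfK ?gt_eqF //; apply: eqw; rewrite ?hzE ?htE //.
  have -> : a w1 = ht w1 / ht w0 * a w0.
    by rewrite mulrAC aE mulrC mulKf ?gt_eqF.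
  by rewrite /a; clear; case: (hz w0) p => [? ?] [? ?] /=; ring.
have -> : b w1 = ht w1 / ht w0 * b w0.
  by rewrite mulrAC bE mulrC mulKf ?gt_eqF.
by rewrite /b; clear; case: (hz w0) p => [? ?] [? ?] /=; ring.
Qed.

End Patches.

(** * Isometric spheres under the action *)

Section DFDomain.
Local Open Scope complex_scope.
Variable R : realType.
Local Notation C := R[i].
Local Notation H3 := (H3 R).
Local Notation M2 := 'M[C]_2.

(** If [x] has squared distance E from the center and r is the radius, then [act g x] has squared
    distance r^4 / E from the center of the other sphere. Both E >= r^2 and r^4 / E >= r^2 force E =
    r^2. *)
Lemma iso_sphere_act (g : M2) (x : H3) : \det g = 1 -> g 1 0 != 0 ->
  0 <= hplane_eqn (iso_sphere g) x ->
  0 <= hplane_eqn (iso_sphere g^-1) (act g x) ->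
  hplane_set (iso_sphere g) x.
Proof.
move=> dg c0; rewrite /hplane_set /hplane_eqn /=.
have [-> ->] := actE x dg c0; have := gamma1E x c0.
set k := _ / _ => -[_ -> ->].
rewrite iso_radius_inv // (addrAC (iso_center g^-1)) subrr add0r cabsN.
rewrite cabs_conj_mul_div // (addrAC (iso_center g)) subrr add0r Normc.normcM.
have r0 : 0 < iso_radius g by rewrite /iso_radius invr_gt0 cabs_gt0.
have E0 : 0 < cabs (hz x - iso_center g) ^+ 2 + ht x ^+ 2.
  by rewrite ltr_wpDl ?sqr_ge0 // exprn_gt0 // ht_gt0.
have ck (l : R) : cabs l%:C ^+ 2 = l ^+ 2 by rewrite cabs_sqr /= expr0n addr0.
rewrite [(cabs k%:C * _) ^+ 2]exprMn ck [(k * _) ^+ 2]exprMn -mulrDr /k.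
set E := cabs _ ^+ 2 + _ in E0 *; have r20 : 0 < iso_radius g ^+ 2 by rewrite exprn_gt0.
have -> : (iso_radius g ^+ 2 / E) ^+ 2 * E = iso_radius g ^+ 2 * (iso_radius g ^+ 2 / E).
  by field; rewrite gt_eqF.
rewrite !subr_ge0 => rE; rewrite -{1}[iso_radius g ^+ 2]mulr1 ler_pM2l //.
rewrite ler_pdivlMr // mul1r => Er.
by apply/eqP; rewrite subr_eq0 eq_le rE Er.
Qed.

(** * Elements fixing infinity *)

(** On C, [g] has derivative a^2 with a = [g 0 0], so conjugation by [g] scales translations by a^2.
    The entries are read off from q g = g p. *)
Lemma conj_upper_triangular (g p : M2) : \det g = 1 -> g 1 0 = 0 -> p 1 0 = 0 ->
  [/\ (g * p * g^-1) 0 0 = p 0 0, (g * p * g^-1) 1 0 = 0,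
      (g * p * g^-1) 1 1 = p 1 1 &
      p 1 1 = p 0 0 -> (g * p * g^-1) 0 1 = g 0 0 ^+ 2 * p 0 1].
Proof.
move=> dg g0 p0; have dE := dg; rewrite det_mx2 g0 mulr0 subr0 in dE.
have a0 : g 0 0 != 0.
  by apply/eqP => a0; move/eqP: dE; rewrite a0 mul0r eq_sym oner_eq0.
have d0 : g 1 1 != 0.
  by apply/eqP => d0; move/eqP: dE; rewrite d0 mulr0 eq_sym oner_eq0.
have ug : g \is a GRing.unit by rewrite unitmxE dg unitr1.
have : g * p * g^-1 * g = g * p by rewrite mulrVK.
move: (g * p * g^-1) => q E.
have e (i j : 'I_2) := congr1 (fun m : M2 => m i j) E.
have q00 : q 0 0 = p 0 0.
  apply: (mulIf a0); move: (e 0 0).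
  by rewrite !mulmx2E g0 p0 !mulr0 !addr0 mulrC [RHS]mulrC => ->; rewrite mulrC.
have q10 : q 1 0 = 0.
  apply: (mulIf a0); move: (e 1 0).
  by rewrite !mulmx2E g0 p0 !mulr0 !mul0r !addr0.
have q11 : q 1 1 = p 1 1.
  apply: (mulIf d0); move: (e 1 1).
  by rewrite !mulmx2E g0 q10 !mul0r !add0r [RHS]mulrC.
split=> // pE; apply: (mulIf d0); move: (e 0 1).
rewrite !mulmx2E q00 pE => H.
have -> : g 0 0 ^+ 2 * p 0 1 * g 1 1 = g 0 0 * p 0 1 * (g 0 0 * g 1 1) by ring.
rewrite dE mulr1.
apply: (addrI (p 0 0 * g 0 1)); rewrite H; ring.
Qed.

Lemma mxtrace2 (m : M2) : \tr m = m 0 0 + m 1 1.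
Proof.
rewrite /mxtrace big_ord_recl big_ord1.
by rewrite (_ : lift ord0 ord0 = 1) //; apply/val_inj.
Qed.

(* The conjugates of [p] by powers of [g] accumulate at the identity of PSL_2(C). *)
Lemma no_contraction_with_parabolic (G : set M2) (g p : M2) :
  is_kleinian G -> G g -> g 1 0 = 0 -> cabs (g 0 0) < 1 ->
  G p -> p 1 0 = 0 -> is_parabolic p -> False.
Proof.
move=> [[Gdet G1 GN GM GV] Gd] Gg g0 a1 Gp p0 [pn trp].
have dp := Gdet _ Gp; have dE := dp; rewrite det_mx2 p0 mulr0 subr0 in dE.
(* Here (p00 - p11)^2 = tr^2 - 4 det = 0, so both diagonal entries are the same sign. *)
have [eps epsE [pa pd]] : exists2 eps : C, eps = 1 \/ eps = -1 &
    p 0 0 = eps /\ p 1 1 = eps.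
  rewrite mxtrace2 in trp.
  have sq : (p 0 0 - p 1 1) ^+ 2 = 0.
    have -> : (p 0 0 - p 1 1) ^+ 2 = (p 0 0 + p 1 1) ^+ 2 - 4 * (p 0 0 * p 1 1) by ring.
    by rewrite dE; case: trp => ->; ring.
  move/eqP: sq; rewrite sqrf_eq0 subr_eq0 => /eqP ad.
  exists (p 0 0) => //; rewrite ad in trp *.
  have two0 : (2 : C) != 0 by rewrite pnatr_eq0.
  by case: trp => e; [left|right]; apply: (mulfI two0); rewrite ?mulr1 ?mulrN1 mulr_natl mulr2n e.
(* [E] is the limit of the conjugates, [eps] times the identity. *)
have [E [GE tE] [E00 E01 E10 E11]] : exists2 E : M2, G E /\ psl_trivial E &
    [/\ E 0 0 = eps, E 0 1 = 0, E 1 0 = 0 & E 1 1 = eps].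
  case: epsE => ->; [exists 1 | exists (-1)]; rewrite ?mxE /= ?oppr0 //.
  - by split=> //; left.
  - by split; [exact: GN | right].
have ordE (k : 'I_2) : k = 0 \/ k = 1.
  by case: k => -[|[|//]] k2; [left|right]; apply/val_inj.
have m2P (m n : M2) : m 0 0 = n 0 0 -> m 0 1 = n 0 1 -> m 1 0 = n 1 0 ->
    m 1 1 = n 1 1 -> m = n.
  move=> e1 e2 e3 e4; apply/matrixP => i j.
  by case: (ordE i) => ->; case: (ordE j) => ->.
have b0 : p 0 1 != 0.
  apply/eqP => b0; apply: pn.
  have -> // : p = E.
  by apply: m2P; rewrite ?E00 ?E01 ?E10 ?E11.
have [e e0 eP] := Gd _ GE.
(* [q] is the conjugate of [p] by g^n. *)
have seqP n : exists q : M2, [/\ G q, q 0 0 = eps, q 1 1 = eps, q 1 0 = 0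
    & q 0 1 = g 0 0 ^+ (2 * n) * p 0 1].
  elim: n => [|n [q [Gq qa qd qc qb]]]; first by exists p; split=> //; rewrite mul1r.
  have [E1 E2 E3 E4] := conj_upper_triangular (Gdet _ Gg) g0 qc.
  exists (g * q * g^-1); split; rewrite ?E1 ?E2 ?E3 ?E4 ?qa ?qd //.
    by apply: (GM); [exact: GM | exact: GV].
  by rewrite qb mulnS exprD mulrA.
have [n nP] : exists n, cabs (g 0 0 ^+ (2 * n) * p 0 1) < e.
  have z1 : `|cabs (g 0 0) ^+ 2| < 1.
    by rewrite ger0_norm ?sqr_ge0 // expr_lt1 // cabs_ge0.
  have := @cvgr0_norm_lt _ _ _ _ _ _ (cvg_geometric (cabs (p 0 1)) z1) e e0.
  move=> [n _ /(_ n (leqnn n))] /=.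
  rewrite ger0_norm; last by rewrite mulr_ge0 ?cabs_ge0 // exprn_ge0 ?sqr_ge0.
  move=> H; exists n; rewrite Normc.normcM mulrC (_ : cabs (_ ^+ _) = (cabs (g 0 0) ^+ 2) ^+ n) //.
  rewrite exprM; elim: n {H} => [|n IH]; first by rewrite !expr0 Normc.normc1.
  rewrite [in LHS]exprS Normc.normcM IH [in RHS]exprS; congr (_ * _).
  exact: Normc.normcM.
have [q [Gq qa qd qc qb]] := seqP n.
(* Discreteness at [E] makes this conjugate equal to [E]; its upper right entry then vanishes, so
   [g 0 0] = 0, against det g = 1. *)
have qE : q = E.
  apply: eP => // i j.
  by case: (ordE i) => ->; case: (ordE j) => ->;
    rewrite ?qa ?qd ?qc ?qb ?E00 ?E01 ?E10 ?E11 ?subrr ?subr0 ?Normc.normc0.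
have : q 0 1 = 0 by rewrite qE.
rewrite qb => /eqP; rewrite mulf_eq0 (negbTE b0) orbF.
rewrite expf_eq0 => /andP[_ /eqP a0].
by move/eqP: (Gdet _ Gg); rewrite det_mx2 a0 g0 mul0r mulr0 subr0 eq_sym oner_eq0.
Qed.

(** Neither [g] nor its inverse contracts, so |g00| = 1. Since g00 g11 = 1, the diagonal entries are
    conjugate and the trace is twice a real part. *)
Lemma stab_infty_trace_real (G : set M2) (g p : M2) :
  is_kleinian G -> G g -> g 1 0 = 0 ->
  G p -> p 1 0 = 0 -> is_parabolic p -> \tr g \is Num.real.
Proof.
move=> hK Gg g0 Gp p0 pp; have [[Gdet _ _ _ GV] _] := hK.
have dg := Gdet _ Gg; have dE := dg; rewrite det_mx2 g0 mulr0 subr0 in dE.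
have [iV10 iV11] := inv_mx2 dg.
have a1 : cabs (g 0 0) = 1.
  apply/eqP; rewrite eq_le !leNgt; apply/andP; split; apply/negP => H.
    have dgV := det1_inv dg; rewrite det_mx2 iV10 g0 oppr0 mulr0 subr0 iV11 in dgV.
    apply: (@no_contraction_with_parabolic G g^-1 p) => //; first exact: GV.
      by rewrite iV10 g0 oppr0.
    have : cabs (g^-1 0 0) * cabs (g 0 0) = 1 by rewrite -Normc.normcM dgV Normc.normc1.
    have := cabs_ge0 (g^-1 0 0).
    by move: (cabs _) (cabs _) H => u v *; nra.
  exact: (@no_contraction_with_parabolic G g p).
have dC : g 1 1 = conjc (g 0 0).
  have a0 : g 0 0 != 0 by rewrite -cabs_eq0 a1 oner_eq0.
  by apply: (mulfI a0); rewrite dE -cabs2C a1 expr1n.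
by rewrite mxtrace2 dC -Re2C complex_real.
Qed.


(** * Side-pairings that move infinity *)

Lemma side_pairing_center (G : set M2) (D : set C) (w0 : H3) (g : M2) :
  is_PSL2_subgroup G ->
  outside_iso_spheres G `&` chimney D = dirichlet_domain G w0 ->
  side_pairing G (dirichlet_domain G w0) g -> ~ stab_infty G g ->
  act g (gamma1 g w0) = w0.
Proof.
move=> [Gdet _ _ GM GV] PE [Gg Fside] nst.
have dg := Gdet _ Gg.
have c0 : g 1 0 != 0 by apply/eqP => c0; apply: nst.
have [iV10 _] := inv_mx2 dg.
have nt : ~ psl_trivial g.
  by case=> gE; move/eqP: c0; rewrite gE !mxE //= oppr0.
have GVg := GV _ Gg.
have cV0 : g^-1 1 0 != 0 by rewrite iV10 oppr_eq0.
have nstV : ~ stab_infty G g^-1 by case=> _ /eqP; rewrite (negbTE cV0).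
have ntV : ~ psl_trivial g^-1.
  by case=> gE; move/eqP: cV0; rewrite gE !mxE //= oppr0.
set P := dirichlet_domain G w0 in PE Fside *.
have outP x : P x -> outside_iso_spheres G x by rewrite -PE => -[].
have inS x : P x -> P (act g x) -> hplane_set (iso_sphere g) x.
  move=> /outP Px /outP Pgx; apply: iso_sphere_act => //; first exact: Px.
  exact: Pgx.
(* One inequality is the Dirichlet condition at [x], the other is the condition at [act g x] carried
   back by the isometry. *)
have bis x : P x -> P (act g x) -> hdist x w0 = hdist x (act g^-1 w0).
  move=> Px Pgx; apply/eqP; rewrite eq_le (Px _ GVg ntV) /=.
  rewrite -(hdist_act _ (act g^-1 w0) dg c0) actVK // -(hdist_act x w0 dg c0).
  exact: (Pgx _ Gg nt).
have FP x : (P `&` act g^-1 @` P) x -> P x /\ P (act g x).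
  by move=> [Px [y Py xE]]; split=> //; rewrite -xE actVK.
have FS : P `&` act g^-1 @` P `<=` hplane_set (iso_sphere g).
  by move=> x /FP[]; exact: inS.
have [x [y1 [y2 [m m0 [Fx F1 F2 z1 z2]]]]] := side_in_hemisphere_points Fside FS.
have := bisector_hemisphere_center m0 z1 z2 (p := iso_center g) (r := iso_radius g)
  (w0 := w0) (w1 := act g^-1 w0).
case.
- have SF y : (P `&` act g^-1 @` P) y ->
    hplane_set (iso_sphere g) y /\ hdist y w0 = hdist y (act g^-1 w0).
    by move=> Fy; split; [exact: FS | case: (FP _ Fy); exact: bis].
  by move=> y; rewrite !inE => /or3P[] /eqP ->; exact: SF.
(* If [w0] is fixed, [g] maps [P] into itself. The Ford description keeps the point one unit above
   [x] in [P], so it and [x] would both lie on the isometric sphere. *)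
- move=> fixw.
  have fixw' : act g w0 = w0 by rewrite -{1}fixw actVK.
  have [Px _] := FP _ Fx.
  have gP y : P y -> P (act g y).
    move=> Py h Gh hnt; rewrite -{1}fixw' hdist_act //.
    rewrite -[X in _ <= X](hdist_act _ _ (det1_inv dg) cV0) actK // -actM ?(det1_inv dg) ?Gdet //.
    have [tr|ntr] := pselect (psl_trivial (g^-1 * h)); last by apply: Py; [exact: GM|].
    by rewrite (act_trivial _ tr).
  have t0 := ht_gt0 x; have ts : 0 < ht x + 1 by rewrite addr_gt0.
  have Py : P (mkH3 (hz x) (ht x + 1)).
    move: Px; rewrite -PE => -[ox Dx]; split; last by rewrite /chimney /= hzE.
    move=> h Gh hst; have := ox h Gh hst.
    by rewrite !hemisphere_eqnE hzE // htE //; nra.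
  have := inS _ Py (gP _ Py); have := inS _ Px (gP _ Px).
  rewrite /hplane_set -![[set _ | _] _]/(hplane_eqn _ _ = 0) !hemisphere_eqnE hzE // htE //.
  move=> H1 H2; have : 0 < 2 * ht x + 1 by rewrite addr_gt0 ?mulr_gt0.
  rewrite lt_neqAle => /andP[/eqP + _]; case; apply/esym.
  have -> : 2 * ht x + 1 = (ht x + 1) ^+ 2 - ht x ^+ 2 by ring.
  by lra.
by move=> E; rewrite /gamma1 -E actVK.
Qed.

(* A priori [act g \o gamma1 g] is a Euclidean glide reflection, by [actE]. *)
Lemma act_gamma1_fix (g : M2) (w0 : H3) : \det g = 1 -> g 1 0 != 0 ->
  act g (gamma1 g w0) = w0 ->
  [/\ act g \o gamma1 g = gamma2 g,
      vertical_axis (hz w0) `<=` hplane_set (R_plane g)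
    & \tr g \is Num.real].
Proof.
move=> dg c0 fw.
have cc0 : conjc (g 1 0) != 0 by rewrite conjc_eq0.
have fE y : hz (act g (gamma1 g y)) = iso_center g^-1
    - conjc (g 1 0) / g 1 0 * conjc (hz y - iso_center g).
  by have [-> _] := actE (gamma1 g y) dg c0; rewrite gamma1K.
have tE y : ht (act g (gamma1 g y)) = ht y.
  by have [_ ->] := actE (gamma1 g y) dg c0; rewrite gamma1K.
have zE := fE w0; rewrite fw in zE.
(* A reflection with normal n has linear part - (n / conj n) conj z; n = conj c matches
   [act g \o gamma1 g], and the line must pass through the fixed point. *)
pose v := (hz w0, conjc (g 1 0)); have n0 : v.2 <> 0 by apply/eqP.
have pE : iso_center g^-1 = v.1 - v.2 / conjc v.2 * conjc (iso_center g - v.1).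
  rewrite /= conjcK !conjcD !conjcN in zE *.
  by rewrite {1}zE; ring.
have rE : act g \o gamma1 g = hreflection (Vertical v).
  apply/funext => y; apply: H3_eq; last by rewrite ht_vreflection /= tE.
  by rewrite (hz_vreflection_swap y n0 pE) /= fE conjcK.
have sw := (vreflection_swapP dg c0 n0).2 pE.
have vP : is_R_plane g v.
  split=> // [_|SE].
    split=> //; rewrite -sw image_comp.
    by rewrite (_ : _ \o _ = id) ?image_id //; apply/funext => y; exact: vreflectionK.
  split; last by apply/funext => y; rewrite -rE /= gamma1K.
  apply/(vertical_axis_subP _ n0); rewrite -pE.
  exact/(iso_sphere_eq dg c0).
(* The chosen parameters [w] of [R_plane g] share with [v] only the plane; two points of its base
   line recover the linear part of the reflection. *)
have vE := R_plane_unique dg c0 vP; have [w wE wP] := R_planeP dg c0.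
have [m0 qE] := is_R_planeP dg c0 wP; rewrite wE in vE.
have ax : vertical_axis (hz w0) `<=` hplane_set (Vertical w).
  by rewrite -vE; apply/(vertical_axis_subP _ n0); rewrite /= subrr conjc0 mulr0 subr0.
(* Multiplying the normal by i gives the direction of the line, hence a second point on it. *)
pose i : C := 0 +i* 1.
have conj_i : conjc i = - i by apply/eqP; rewrite eq_complex /= oppr0 !eqxx.
have i0 : i != 0 by rewrite eq_complex /= oner_eq0 andbF.
have ax' : vertical_axis (hz w0 + i * conjc (g 1 0)) `<=` hplane_set (Vertical w).
  rewrite -vE; apply/(vertical_axis_subP _ n0) => /=.
  rewrite conjcK (addrC (hz w0)) addrK conjcM conjcK.
  by rewrite conj_i; field.
have bE : w.2 / conjc w.2 = conjc (g 1 0) / g 1 0.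
  move/(vertical_axis_subP _ m0): ax => e1; move/(vertical_axis_subP _ m0): ax' => e2.
  apply: (mulIf c0); rewrite divfK //; apply: (mulfI i0).
  have -> : i * conjc (g 1 0) = (hz w0 + i * conjc (g 1 0)) - hz w0 by ring.
  rewrite [X in _ = X - _]e2 [X in _ = _ - X]e1.
  rewrite !conjcD conjcM conj_i conjcK; ring.
split; last 2 first.
- by rewrite wE.
- rewrite mxtrace2.
  (* Multiplied by c, the fixed-point equation reads a - conj d = c z0 + conj (c z0), a real
     number. *)
  have -> : g 0 0 + g 1 1 = (g 0 0 - conjc (g 1 1)) + (g 1 1 + conjc (g 1 1)) by ring.
  have -> : g 0 0 - conjc (g 1 1) = g 1 0 * hz w0 + conjc (g 1 0 * hz w0).
    rewrite {1}zE iso_center_inv // /iso_center conjcD conjcN.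
    rewrite mulNr [conjc (- _)]conjcN [conjc (_ / _)]conjcM conjcV conjcM.
    by field; rewrite c0 cc0.
  by rewrite -!Re2C -real_complexD complex_real.
rewrite /gamma2 wE rE; apply/funext => y; apply: H3_eq; last by rewrite !ht_vreflection.
by rewrite (hz_vreflection_swap y n0 pE) (hz_vreflection_swap y m0 qE) bE /= conjcK.
Qed.

End DFDomain.

(** * Assembly: the common axis stands over the Dirichlet center *)

Theorem theorem7p3 (R : realType) (G : set 'M[R[i]%C]_2) (P : set (H3 R))
    (hK : is_kleinian G) (hfg : finitely_generated G)
    (hcov : finite_covolume G) (hcusp : has_parabolic_Z2 (stab_infty G))
    (hP : is_DF_domain G P) :
  [/\ exists z0 : R[i]%C, forall g : 'M[R[i]%C]_2,
        side_pairing G P g -> ~ stab_infty G g ->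
        vertical_axis z0 `<=` hplane_set (R_plane g),
      forall g : 'M[R[i]%C]_2,
        side_pairing G P g -> ~ stab_infty G g ->
        gamma43 g = id /\ act g = gamma2 g \o gamma1 g
    & forall g : 'M[R[i]%C]_2, side_pairing G P g -> \tr g \is Num.real].
Proof.
have [hG _] := hK; have [Gdet _ _ _ _] := hG.
case: hP => _ [D [_ _ PD]] [w0 Pw].
have neq0 (g : 'M[R[i]%C]_2) : G g -> ~ stab_infty G g -> g 1 0 != 0.
  by move=> Gg nst; apply/eqP => g0; apply: nst.
have key (g : 'M[R[i]%C]_2) : side_pairing G P g -> ~ stab_infty G g ->
    [/\ act g \o gamma1 g = gamma2 g,
      vertical_axis (hz w0) `<=` hplane_set (R_plane g) & \tr g \is Num.real].
  move=> sp nst; have Gg := sp.1.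
  apply: (act_gamma1_fix (Gdet _ Gg) (neq0 _ Gg nst)).
  apply: (side_pairing_center (D := D) hG) nst; first by rewrite -PD.
  by rewrite -Pw.
split.
- by exists (hz w0) => g sp /(key _ sp)[].
- move=> g sp nst; have [gE _ _] := key g sp nst.
  have Gg := sp.1; have dg := Gdet _ Gg; have c0 := neq0 _ Gg nst.
  (* By [gE], [gamma43 g] is the reflection [gamma2 g] applied twice. *)
  have id43 : gamma43 g = id.
    have [v vE /(is_R_planeP dg c0)[n0 _]] := R_planeP dg c0.
    apply/funext => x; rewrite /gamma43 -/((act g \o gamma1 g) (gamma2 g x)).
    by rewrite /= -[act g _]/((act g \o gamma1 g) _) gE /gamma2 vE vreflectionK.
  by split=> //; rewrite {1}(gamma_decomposition dg c0) id43.
- move=> g sp; have [st|nst] := pselect (stab_infty G g); last by case: (key g sp nst).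
  (* The exponents (1, 0) single out [g1] as a parabolic element fixing infinity. *)
  have [g1 [h1 [[Gg1 c1] _ _ /(_ 1 0)]]] := hcusp.
  rewrite expr1z expr0z mulr1 => /(_ ltac:(by case)) par.
  exact: (stab_infty_trace_real hK st.1 st.2 Gg1 c1 par).
Qed.
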